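(* In the finite environment with conditionally i.i.d. signals $\omega_i$, $i\in\{1,\dots,n\}$, described in the context, the state is learned perfectly in the limit: $$\lim_{n\to\infty}\mathbb E\left[U(\mu'(\omega_1,\dots,\omega_n))\,\middle|\,\omega_0\right]=U(\delta_{\omega_0})\quad\text{a.s.},$$ and the sum of all senders' residual values vanishes: $$\lim_{n\to\infty} n\,\mathbb E_{\boldsymbol\omega_{-i}}\left[\bar v(\tilde\omega_i\mid\boldsymbol\omega_{-i})\right]=0,$$ where for each $n$ the index $i\in\{1,\dots,n\}$ is arbitrary (the expectation does not depend on $i$ by symmetry).
   Context: There are finitely many actions $A=\{a_1,\dots,a_K\}$ and finitely many payoff-relevant states $\Omega_0=\{\omega_0^1,\dots,\omega_0^M\}$ with $M\le K<\infty$. The utility is $u(a,\omega_0)$, depending on the state only through $\omega_0$. For each $j\le M$, action $a_j$ is strictly best in state $\omega_0^j$: $u(a_k,\omega_0^j)<u(a_j,\omega_0^j)$ for all $k\ne j$. There is a prior $\mu^0$ over $\omega_0$. There are $n$ senders with components $\omega_1,\dots,\omega_n$ that, conditionally on $\omega_0$, are i.i.d. draws from a density $f(\cdot\mid\omega_0)$ (with respect to a common dominating measure). For any pair $\omega_0^j\ne\omega_0^\ell$, the distributions with densities $f(\cdot\mid\omega_0^j)$ and $f(\cdot\mid\omega_0^\ell)$ are mutually absolutely continuous and not equal. For a belief $\mu$ over $\omega_0$, $U(\mu)=\max_{a\in A}\mathbb E_{\omega_0\sim\mu}[u(a,\omega_0)]$; $\delta_{\omega_0}$ is the point mass at $\omega_0$.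 $\mu'(\omega_1,\dots,\omega_n)$ is the Bayesian posterior about $\omega_0$ obtained from the prior after observing $\omega_1,\dots,\omega_n$. Let $\boldsymbol\omega_{-i}=(\omega_j)_{1\le j\le n,\,j\ne i}$ and let $\mu'(\boldsymbol\omega_{-i})$ be the posterior after observing $\boldsymbol\omega_{-i}$. The residual value of sender $i$'s component is $$\bar v(\tilde\omega_i\mid\boldsymbol\omega_{-i})=\mathbb E\left[U(\mu'(\omega_1,\dots,\omega_n))\mid\boldsymbol\omega_{-i}\right]-U(\mu'(\boldsymbol\omega_{-i})),$$ and $\mathbb E_{\boldsymbol\omega_{-i}}$ is the expectation over $\boldsymbol\omega_{-i}$ under the prior. *)

(* Defs.v *)
From HB Require Import structures.
From mathcomp Require Export all_boot all_order all_algebra.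
From mathcomp Require Export all_classical all_reals all_analysis.
Export Order.TTheory GRing.Theory Num.Theory.
Export numFieldNormedType.Exports.

Set Implicit Arguments.
Unset Strict Implicit.
Unset Printing Implicit Defensive.

Local Open Scope classical_set_scope.
Local Open Scope ring_scope.

(* The actions are 'I_K.+1 and the payoff-relevant states 'I_M.+1: neither set
   is empty, as a maximum is taken over the former and the latter carries a
   prior. A belief is given by its probability weights. *)

Definition is_belief (R : realType) (M : nat) (mu : 'I_M.+1 -> R) : Prop :=
  (forall j, 0 <= mu j) /\ \sum_j mu j = 1.

Definition point_belief (R : realType) (M : nat) (j : 'I_M.+1) : 'I_M.+1 -> R :=
  fun l => (l == j)%:R.

Definition expected_utility (R : realType) (K M : nat)
    (u : 'I_K.+1 -> 'I_M.+1 -> R) (mu : 'I_M.+1 -> R) (a : 'I_K.+1) : R :=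
  \sum_j mu j * u a j.

Definition value (R : realType) (K M : nat)
    (u : 'I_K.+1 -> 'I_M.+1 -> R) (mu : 'I_M.+1 -> R) : R :=
  \big[Num.max/expected_utility u mu ord0]_(a < K.+1) expected_utility u mu a.

Definition is_density (R : realType) d (T : measurableType d)
    (nu : {measure set T -> \bar R}) (f : T -> R) : Prop :=
  [/\ measurable_fun setT f, forall x, 0 <= f x
    & (\int[nu]_x (f x)%:E = 1)%E].

Definition density_law (R : realType) d (T : measurableType d)
    (nu : {measure set T -> \bar R}) (f : T -> R) (A : set T) : \bar R :=
  (\int[nu]_(x in A) (f x)%:E)%E.

(* Bayes' rule after observing the components x k with S k. Where the
   normalizing sum vanishes, which has probability 0, all weights are 0. *)
Definition posterior (R : realType) (M : nat) (mu0 : 'I_M.+1 -> R)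
    (T : Type) (f : 'I_M.+1 -> T -> R) (n : nat) (S : pred 'I_n)
    (x : 'I_n -> T) : 'I_M.+1 -> R :=
  fun j => mu0 j * \prod_(k < n | S k) f j (x k) /
           \sum_l mu0 l * \prod_(k < n | S k) f l (x k).

(* On the probability space (W, P), the state theta has law mu0 and, given
   theta = j, the n components X k are i.i.d. with density f j. *)
Definition cond_iid (R : realType) dW (W : measurableType dW)
    (P : probability W R) (M : nat) (mu0 : 'I_M.+1 -> R)
    d (T : measurableType d) (nu : {measure set T -> \bar R})
    (f : 'I_M.+1 -> T -> R) (theta : W -> 'I_M.+1)
    (n : nat) (X : 'I_n -> {RV P >-> T}) : Prop :=
  forall j : 'I_M.+1,
  [/\ measurable (theta @^-1` [set j]),
      P (theta @^-1` [set j]) = (mu0 j)%:E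
    & forall B : 'I_n -> set T, (forall k, measurable (B k)) ->
      P (theta @^-1` [set j] `&` [set w | forall k, B k (X k w)]) =
      (P (theta @^-1` [set j]) * \prod_(k < n) density_law nu (f j) (B k))%E].

(* g is a version of E[Y | G], for a sub-sigma-algebra G. *)
Definition is_cond_exp (R : realType) dW (W : measurableType dW)
    (P : probability W R) (G : set (set W)) (Y g : W -> R) : Prop :=
  [/\ forall B : set R, measurable B -> G (g @^-1` B),
      P.-integrable setT (EFin \o g)
    & forall A, G A ->
      (\int[P]_(w in A) (g w)%:E = \int[P]_(w in A) (Y w)%:E)%E].

Definition sigma_state (W : Type) (M : nat) (theta : W -> 'I_M.+1) :
    set (set W) :=
  preimage_set_system setT theta setT.

Definition sigma_signals (R : realType) dW (W : measurableType dW)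
    (P : probability W R) d (T : measurableType d)
    (n : nat) (S : pred 'I_n) (X : 'I_n -> {RV P >-> T}) : set (set W) :=
  <<s \big[setU/set0]_(k < n | S k)
        preimage_set_system setT (X k) measurable >>.

Definition posterior_value (R : realType) (K M : nat)
    (u : 'I_K.+1 -> 'I_M.+1 -> R) (mu0 : 'I_M.+1 -> R)
    dW (W : measurableType dW) (P : probability W R)
    d (T : measurableType d) (f : 'I_M.+1 -> T -> R)
    (n : nat) (S : pred 'I_n) (X : 'I_n -> {RV P >-> T}) : W -> R :=
  fun w => value u (posterior mu0 f S (fun k => X k w)).

(* v is a version of the residual value of component i, as a random variable
   (a function of the other components). *)
Definition is_residual_value (R : realType) (K M : nat)
    (u : 'I_K.+1 -> 'I_M.+1 -> R) (mu0 : 'I_M.+1 -> R)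
    dW (W : measurableType dW) (P : probability W R)
    d (T : measurableType d) (f : 'I_M.+1 -> T -> R)
    (n : nat) (X : 'I_n -> {RV P >-> T}) (i : 'I_n) (v : W -> R) : Prop :=
  exists2 g : W -> R,
    is_cond_exp P (sigma_signals (predC1 i) X)
      (posterior_value u mu0 f predT X) g
    & forall w, v w = g w - posterior_value u mu0 f (predC1 i) X w.

(* Main.v *)
(* On the event theta = j, the posterior weight of another state l is at most a
   constant times the product of sqrt (f_l / f_j) over the observed components.
   The conditional expectation of that product is the n-th power of the
   Bhattacharyya coefficient of f_l and f_j, which is < 1 because the two
   densities define different laws. As the value of a belief is Lipschitz in
   its weights, the expected distance between the value of the posterior and
   the value under full information is O(r^n) for some r < 1. The expectation
   of a residual value is bounded by the sum of two such distances, so n times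
   it is O(n r^n). *)
Require Import Defs.
From mathcomp Require Import measurable_realfun.
From mathcomp Require Import ring lra.
Set Implicit Arguments.
Unset Strict Implicit.
Unset Printing Implicit Defensive.
Import HBNNSimple.
Local Open Scope classical_set_scope.
Local Open Scope ring_scope.

(** * Weighted integrals determined by their values on indicators *)

Section transfer.
Local Open Scope ereal_scope.
Context d (T : measurableType d) (R : realType).

(** The right-hand side involves [mu], [Y] and [G] only through integrals of [G] against indicators
    of [Y], while the sets and coefficients depend on [phi] alone. Two settings that agree on
    indicators therefore agree on [phi]. The identity is monotone convergence along simple
    functions. *)
Lemma weighted_integral_approx d' (X : measurableType d')
    (mu : {measure set X -> \bar R}) (Y : X -> T) (mY : measurable_fun setT Y)
    (G : X -> R) (mG : measurable_fun setT G) (G0 : forall x, (0 <= G x)%R)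
    (phi : T -> R) (mphi : measurable_fun setT (EFin \o phi))
    (phi0 : forall t, (0 <= phi t)%R) :
  let h := nnsfun_approx measurableT mphi in
  \int[mu]_x (G x * phi (Y x))%:E =
  limn (fun n => \sum_(y \in range (h n))
    (y%:E * \int[mu]_x (G x * \1_(h n @^-1` [set y]) (Y x))%:E)).
Proof.
move=> h.
have mh n : measurable_fun setT (fun x => h n (Y x)).
  exact: measurableT_comp.
have phi0' t : [set: T] t -> 0 <= (EFin \o phi) t by rewrite /= lee_fin.
transitivity (\int[mu]_x limn (fun n => (G x * h n (Y x))%:E)).
  apply: eq_integral => x _; apply/esym/cvg_lim => //.
  have cphi : (h n (Y x))%:E @[n --> \oo] --> (phi (Y x))%:E.
    exact: (cvg_nnsfun_approx measurableT mphi phi0').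
  by under eq_fun do rewrite EFinM; rewrite EFinM; exact: cvgeZl.
rewrite monotone_convergence//; last 3 first.
- by move=> n; apply/measurable_EFinP; exact: measurable_funM.
- by move=> n x _; rewrite lee_fin mulr_ge0.
- move=> x _ a b ab; rewrite lee_fin ler_wpM2l//.
  exact/lefP/nd_nnsfun_approx.
congr (limn _); apply/funext => n.
transitivity (\int[mu]_x \sum_(y \in range (h n))
   (y%:E * (G x * \1_(h n @^-1` [set y]) (Y x))%:E)).
  apply: eq_integral => x _.
  rewrite EFinM {1}fimfunE -fsumEFin//.
  rewrite ge0_mule_fsumr; last by move=> y; exact: nnfun_muleindic_ge0.
  by apply: eq_fsbigr => y _; rewrite EFinM muleCA.
have mGi y : measurable_fun setT
    (fun x => (G x * \1_(h n @^-1` [set y]) (Y x))%:E).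
  by apply/measurable_EFinP/measurable_funM => //; apply: measurableT_comp.
rewrite ge0_integral_fsum//.
- apply: eq_fsbigr => y; rewrite inE => -[t _ <-].
  by rewrite ge0_integralZl// => [x _|]; rewrite lee_fin// mulr_ge0.
- by move=> y; apply: emeasurable_funM.
- move=> y x _; rewrite -EFinM lee_fin mulrCA mulr_ge0// -lee_fin.
  exact: nnfun_muleindic_ge0.
Qed.

(* Replaces the library's change of variables by a density, which requires
   sigma-finite measures, whereas the dominating measure is arbitrary here. *)
Lemma weighted_integral_transfer d' (X : measurableType d')
    (mu : {measure set X -> \bar R}) (nu : {measure set T -> \bar R})
    (Y : X -> T) (mY : measurable_fun setT Y)
    (G : X -> R) (mG : measurable_fun setT G) (G0 : forall x, (0 <= G x)%R)
    (H : T -> R) (mH : measurable_fun setT H) (H0 : forall t, (0 <= H t)%R) :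
  (forall B, measurable B -> \int[mu]_x (G x * \1_B (Y x))%:E =
     \int[nu]_t (H t * \1_B t)%:E) ->
  forall phi : T -> R, measurable_fun setT phi -> (forall t, (0 <= phi t)%R) ->
  \int[mu]_x (G x * phi (Y x))%:E = \int[nu]_t (H t * phi t)%:E.
Proof.
move=> GH phi /measurable_EFinP mphi phi0.
rewrite (weighted_integral_approx mu mY mG G0 mphi phi0).
rewrite (@weighted_integral_approx _ _ nu id _ H mH H0 phi mphi phi0)//.
congr (limn _); apply/funext => n; apply: eq_fsbigr => y _.
by rewrite GH.
Qed.

End transfer.

(** * Product expectations given the state *)

(** Conditional independence is available for rectangles only; this extends it to products of
    nonnegative functions, so that a product of likelihood-ratio roots integrates to a product of
    Bhattacharyya coefficients. *)
Lemma integral_prod_iid (R : realType) dW (W : measurableType dW)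
    (P : {measure set W -> \bar R}) d (T : measurableType d)
    (nu : {measure set T -> \bar R}) (f : T -> R) (hf : is_density nu f)
    (n : nat) (X : 'I_n -> W -> T) (mX : forall k, measurable_fun setT (X k))
    (A : set W) (mA : measurable A) (p : R) (hp : P A = p%:E) :
  (forall B : 'I_n -> set T, (forall k, measurable (B k)) ->
    P (A `&` [set w | forall k, B k (X k w)]) =
    (P A * \prod_(k < n) density_law nu f (B k))%E) ->
  forall (phi : 'I_n -> T -> R) (r : 'I_n -> R),
    (forall k, measurable_fun setT (phi k)) -> (forall k t, 0 <= phi k t) ->
    (forall k, (\int[nu]_t (f t * phi k t)%:E = (r k)%:E)%E) ->
  (\int[P]_w (\1_A w * \prod_(k < n) phi k (X k w))%:E =
   (p * \prod_(k < n) r k)%:E)%E.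
Proof.
move=> hrect phi r mphi phi0 hr.
have [mf f0 f1] := hf.
have p0 : 0 <= p by rewrite -lee_fin -hp.
(* Only the factors of index below [m] need not be indicators; the induction on
   [m] frees one factor at a time. *)
suff main m : (m <= n)%N -> forall (phi : 'I_n -> T -> R) (r : 'I_n -> R),
    (forall k, measurable_fun setT (phi k)) -> (forall k t, 0 <= phi k t) ->
    (forall k, (\int[nu]_t (f t * phi k t)%:E = (r k)%:E)%E) ->
    (forall k : 'I_n, (m <= k)%N ->
      exists2 B : set T, measurable B & phi k = \1_B) ->
  (\int[P]_w (\1_A w * \prod_(k < n) phi k (X k w))%:E =
   (p * \prod_(k < n) r k)%:E)%E.
  apply: (main n) => // k; rewrite leqNgt ltn_ord//.
move: m {phi r mphi phi0 hr}; elim=> [_|m IH mn] phi r mphi phi0 hr hind.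
  have [B mB hB] : exists2 B : 'I_n -> set T, forall k, measurable (B k) &
      forall k, phi k = \1_(B k).
    have /choice[B hB] k : exists B : set T, measurable B /\ phi k = \1_B.
      by have [B] := hind k isT; exists B.
    by exists B => k; case: (hB k).
  have eqE w : (\1_A w * \prod_(k < n) phi k (X k w))%R =
      \1_(A `&` [set w | forall k, B k (X k w)]) w.
    rewrite indicI; congr (_ * _)%R.
    under eq_bigr do rewrite hB.
    rewrite indicE; case: (asboolP ([set w | forall k, B k (X k w)] w)) => Hw.
      rewrite mem_set//= big1// => k _; rewrite indicE mem_set//; exact: Hw.
    rewrite memNset//=; apply/eqP/prodf_eq0.
    have [k hk] : exists k, ~ B k (X k w) by apply/existsNP.
    by exists k => //; rewrite indicE memNset.
  under eq_integral do rewrite eqE.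
  rewrite integral_indic//; last first.
    apply: measurableI => //.
    have -> : [set w | forall k, B k (X k w)] =
        \bigcap_(k in [set: 'I_n]) (X k @^-1` B k).
      by apply/seteqP; split => w /= h k; [move=> _; exact: h|exact: h].
    apply: fin_bigcap_measurable => // k _.
    by rewrite -[X in measurable X]setTI; exact: mX.
  rewrite setIT hrect// hp EFinM -prodEFin; congr (_ * _)%E.
  apply: eq_bigr => k _.
  rewrite -hr /density_law hB integral_mkcond/=.
  by apply: eq_integral => t _; rewrite patchE indicE;
    case: ifP; rewrite ?mulr1 ?mulr0.
(* The factor of index [m] is the one to free: the weight [G] gathers all the others, and [c] is
   what they contribute to the integral. *)
pose k0 : 'I_n := Ordinal mn.
pose c := (p * \prod_(k < n | k != k0) r k)%R.
pose G w := (\1_A w * \prod_(k < n | k != k0) phi k (X k w))%R.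
have r0 k : 0 <= r k.
  by rewrite -lee_fin -hr; apply: integral_ge0 => t _; rewrite lee_fin mulr_ge0.
have c0 : 0 <= c by rewrite mulr_ge0// prodr_ge0.
have G0 w : 0 <= G w by rewrite mulr_ge0// prodr_ge0.
have mG : measurable_fun setT G.
  apply: measurable_funM; first exact: measurable_indic.
  under eq_fun do rewrite big_mkcond.
  apply: measurable_prod => k _; case: (k != k0) => //.
  exact: measurableT_comp.
transitivity (\int[P]_w (G w * phi k0 (X k0 w))%:E)%E.
  by apply: eq_integral => w _; rewrite (bigD1 k0)//= mulrCA mulrC.
rewrite (@weighted_integral_transfer _ T R _ W P nu (X k0) (mX k0) G mG G0
  (fun t => c * f t)%R)//.
- under eq_integral do rewrite -mulrA EFinM.
  rewrite ge0_integralZl//.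
  + by rewrite hr -EFinM [in RHS](bigD1 k0)//= /c mulrCA mulrC.
  + by apply/measurable_EFinP; exact: measurable_funM.
  + by move=> t _; rewrite lee_fin mulr_ge0.
- exact: measurable_funM.
- by move=> t; exact: mulr_ge0.
(* For an indicator at [k0] the identity is the induction hypothesis, with [phi k0] replaced by
   [\1_B] and [r k0] by the mass of [B]. *)
- move=> B mB.
  pose phi' k := if k == k0 then \1_B else phi k.
  pose r' k := if k == k0 then fine (density_law nu f B) else r k.
  have fB : (\int[nu]_t (f t * \1_B t)%:E = density_law nu f B)%E.
    rewrite /density_law [RHS]integral_mkcond/=.
    apply: eq_integral => t _; rewrite patchE indicE.
    by case: ifP; rewrite ?mulr1 ?mulr0.
  have fBfin : density_law nu f B \is a fin_num.
    rewrite ge0_fin_numE; last first.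
      by apply: integral_ge0 => t _; rewrite lee_fin.
    apply: (@le_lt_trans _ _ (\int[nu]_t (f t)%:E)%E); last by rewrite f1 ltry.
    apply: ge0_subset_integral => //; first exact/measurable_EFinP.
    by move=> t _; rewrite lee_fin.
  have eqphi k : k != k0 -> phi' k = phi k by rewrite /phi' => /negbTE ->.
  have eqR k : k != k0 -> r' k = r k by rewrite /r' => /negbTE ->.
  transitivity (p * \prod_(k < n) r' k)%:E.
    rewrite -(IH (ltnW mn) phi' r').
    + apply: eq_integral => w _; rewrite (bigD1 k0)//= {1}/phi' eqxx /G.
      under [in RHS]eq_bigr => k hk do rewrite eqphi//.
      by rewrite mulrCA mulrC.
    + by move=> k; rewrite /phi'; case: ifP.
    + by move=> k t; rewrite /phi'; case: ifP.
    + by move=> k; rewrite /phi' /r'; case: ifP => // _; rewrite fB fineK.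
    + move=> k mk; rewrite /phi'; case: ifPn => [_|kk0]; first by exists B.
      apply: hind; rewrite ltn_neqAle mk andbT; apply: contra kk0.
      by move=> /eqP mk0; apply/eqP/val_inj.
  under [RHS]eq_integral do rewrite -mulrA EFinM.
  rewrite ge0_integralZl//.
  + rewrite fB -(fineK fBfin) -EFinM (bigD1 k0)//= {1}/r' eqxx /c.
    under eq_bigr => k hk do rewrite eqR//.
    by rewrite mulrCA mulrC.
  + by apply/measurable_EFinP; exact: measurable_funM.
  + by move=> t _; rewrite lee_fin mulr_ge0.
Qed.

(** * Bhattacharyya coefficient of two densities *)

(** On nonnegative reals the inverse is the power with exponent -1, including at 0, where both are
    0. *)
Lemma measurable_funV_ge0 (R : realType) d (T : measurableType d) (g : T -> R) :
  measurable_fun setT g -> (forall t, 0 <= g t) ->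
  measurable_fun setT (fun t => (g t)^-1).
Proof.
move=> mg g0; rewrite (_ : (fun _ => _) = (@powR R ^~ (-1)) \o g).
  by apply: measurableT_comp => //; exact: measurable_powR.
by apply/funext => t /=; rewrite powR_inv1.
Qed.

Lemma measurable_fun_sqrt (R : realType) d (T : measurableType d) (g : T -> R) :
  measurable_fun setT g -> measurable_fun setT (fun t => Num.sqrt (g t)).
Proof.
move=> mg; apply: (measurableT_comp (f := @Num.sqrt R)) mg.
apply: continuous_measurable_fun; exact: sqrt_continuous.
Qed.

(* The integrand equals [sqrt (f t * g t)] also where [f t = 0], as division by
   0 gives 0. *)
Lemma bhattacharyya_lt1 (R : realType) d (T : measurableType d)
    (nu : {measure set T -> \bar R}) (f g : T -> R) (A : set T) :
  is_density nu f -> is_density nu g -> measurable A ->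
  density_law nu f A <> density_law nu g A ->
  exists r : R, [/\ 0 <= r, r < 1 &
    (\int[nu]_t (f t * Num.sqrt (g t / f t))%:E = r%:E)%E].
Proof.
move=> [mf f0 f1] [mg g0 g1] mA neqA.
pose s t := (Num.sqrt (f t) * Num.sqrt (g t))%R.
pose h t := ((Num.sqrt (f t) - Num.sqrt (g t)) ^+ 2)%R.
have s0 t : 0 <= s t by rewrite mulr_ge0// sqrtr_ge0.
have h0 t : 0 <= h t by exact: sqr_ge0.
have ms : measurable_fun setT s.
  by apply: measurable_funM; exact: measurable_fun_sqrt.
have mh : measurable_fun setT h.
  by apply/measurable_funX/measurable_funB; exact: measurable_fun_sqrt.
have fsE t : f t * Num.sqrt (g t / f t) = s t.
  rewrite /s; have [->|fn0] := eqVneq (f t) 0; first by rewrite sqrtr0 !mul0r.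
  rewrite sqrtrM// sqrtrV// mulrCA mulrC; congr (_ * _).
  by rewrite -{1}(sqr_sqrtr (f0 t)) expr2 mulfK// sqrtr_eq0 -ltNge lt0r fn0 f0.
under eq_integral do rewrite fsE.
(* [h] is the integrand of the Hellinger distance. Integrating gives 2 = 2r + q, where r and q are
   the integrals of [s] and [h]. *)
have fghE t : f t + g t = s t + s t + h t.
  rewrite /h /s -{1}(sqr_sqrtr (f0 t)) -{1}(sqr_sqrtr (g0 t)); ring.
have Es : (\int[nu]_t (s t)%:E + \int[nu]_t (s t)%:E + \int[nu]_t (h t)%:E =
           2%:E)%E.
  have := congr1 (fun F => \int[nu]_t (F t)%:E)%E (funext fghE).
  under eq_integral do rewrite EFinD.
  rewrite ge0_integralD//; [|by move=> t _; rewrite lee_fin|exact/measurable_EFinP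
    |by move=> t _; rewrite lee_fin|exact/measurable_EFinP].
  under [RHS]eq_integral do rewrite !EFinD.
  rewrite ge0_integralD//; [|by move=> t _; rewrite -EFinD lee_fin addr_ge0
    |by apply/measurable_EFinP/measurable_funD
    |by move=> t _; rewrite lee_fin|exact/measurable_EFinP].
  rewrite ge0_integralD//; [|by move=> t _; rewrite lee_fin|exact/measurable_EFinP
    |by move=> t _; rewrite lee_fin|exact/measurable_EFinP].
  by rewrite f1 g1 => <-.
have Is0 : (0 <= \int[nu]_t (s t)%:E)%E.
  by apply: integral_ge0 => t _; rewrite lee_fin.
have Ih0 : (0 <= \int[nu]_t (h t)%:E)%E.
  by apply: integral_ge0 => t _; rewrite lee_fin.
(* Nonnegative integrals with a finite sum are finite, which leaves only the real cases. *)
move: Es Is0 Ih0.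
case EH : (\int[nu]_t (h t)%:E)%E => [q| |]//;
  case: (\int[nu]_t (s t)%:E)%E => [r| |]//.
rewrite -!EFinD !lee_fin => -[rq] r0 q0.
(* If r were at least 1, then q would be 0, hence [f] and [g] equal almost everywhere and their laws
   equal on [A]. *)
exists r; split => //; rewrite ltNge; apply/negP => r1; apply: neqA.
have {}EH : (\int[nu]_t `|(h t)%:E| = 0)%E.
  under eq_integral do rewrite gee0_abs ?lee_fin//.
  by rewrite EH; congr (_%:E); lra.
have /measurable_EFinP mh' := mh.
have /(ae_eq_integral_abs nu measurableT mh') aeh := EH.
apply: ge0_ae_eq_integral => //.
- exact/measurable_funTS/measurable_EFinP.
- exact/measurable_funTS/measurable_EFinP.
- by move=> t _; rewrite lee_fin.
- by move=> t _; rewrite lee_fin.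
apply: filterS aeh => t /(_ I) [] /eqP; rewrite sqrf_eq0 subr_eq0 => /eqP fg _.
by rewrite -(sqr_sqrtr (f0 t)) fg sqr_sqrtr.
Qed.

(** * Distance from the value of the posterior to the full-information value *)

(** Each expected utility is linear in the weights with coefficients bounded by [B], and a maximum
    over actions moves no more than its terms do. *)
Lemma value_lipschitz (R : realType) (K M : nat) (u : 'I_K.+1 -> 'I_M.+1 -> R)
    (B : R) (mu mu' : 'I_M.+1 -> R) :
  (forall a j, `|u a j| <= B) ->
  `|value u mu - value u mu'| <= B * \sum_j `|mu j - mu' j|.
Proof.
move=> uB.
suff one_sided m m' : value u m <= value u m' + B * \sum_j `|m j - m' j|.
  rewrite ler_norml; apply/andP; split; last by rewrite lerBlDl one_sided.
  rewrite lerBrDl lerBlDr (le_trans (one_sided mu' mu))// lerD2l.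
  by under eq_bigr do rewrite distrC.
have util a :
    expected_utility u m a <= value u m' + B * \sum_j `|m j - m' j|.
  apply: (@le_trans _ _ (expected_utility u m' a + B * \sum_j `|m j - m' j|)).
    rewrite -lerBlDl /expected_utility -sumrB mulr_sumr ler_sum// => j _.
    by rewrite -mulrBl (le_trans (ler_norm _))// normrM mulrC ler_wpM2r.
  by rewrite lerD2r; exact: le_bigmax.
exact: bigmax_le.
Qed.

(** Squaring reduces this to a b <= (a + b)^2. The simpler bound a / b would not do: a likelihood
    ratio of mutually absolutely continuous laws has mean 1, so its products do not decay in
    expectation. *)
Lemma div_add_le_sqrt (R : realType) (a b : R) :
  0 <= a -> 0 < b -> a / (a + b) <= Num.sqrt (a / b).
Proof.
move=> a0 b0; have ab0 : 0 < a + b by rewrite ltr_wpDl.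
have ab : 0 <= a / b by rewrite divr_ge0// ltW.
have aab : 0 <= a / (a + b) by rewrite divr_ge0// ltW.
rewrite -(ger0_norm aab) -sqrtr_sqr ler_sqrt//.
rewrite expr_div_n ler_pdivrMr ?exprn_gt0// mulrAC ler_pdivlMr//.
rewrite expr2 -mulrA ler_wpM2l// sqrrD expr2.
have : 0 <= a * b by rewrite mulr_ge0// ltW.
have : 0 <= a * a by rewrite mulr_ge0.
have : 0 <= b ^+ 2 by rewrite sqr_ge0.
lra.
Qed.

Lemma sqrtr_prod (R : realType) (I : Type) (s : seq I) (S : pred I) (F : I -> R) :
  (forall i, 0 <= F i) ->
  Num.sqrt (\prod_(i <- s | S i) F i) = \prod_(i <- s | S i) Num.sqrt (F i).
Proof.
move=> F0; elim/big_rec2 : _ => [|i y x _ <-]; first by rewrite sqrtr1.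
by rewrite sqrtrM.
Qed.

Section posterior.
Context (R : realType) (K M : nat) (u : 'I_K.+1 -> 'I_M.+1 -> R) (B : R).
Hypothesis uB : forall a j, `|u a j| <= B.
Context (mu0 : 'I_M.+1 -> R) (hmu0 : is_belief mu0).
Context (T : Type) (f : 'I_M.+1 -> T -> R) (f0 : forall l t, 0 <= f l t).
Context (n : nat) (S : pred 'I_n) (x : 'I_n -> T) (j : 'I_M.+1).
Hypothesis mu0j : 0 < mu0 j.
Hypothesis fj : forall k, 0 < f j (x k).

Let F l := \prod_(k < n | S k) f l (x k).
Let F0 l : 0 <= F l. Proof. by rewrite prodr_ge0. Qed.
Let m0 l : 0 <= mu0 l. Proof. by case: hmu0. Qed.
Let mF0 l : 0 <= mu0 l * F l. Proof. exact: mulr_ge0. Qed.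
Let mFj : 0 < mu0 j * F j. Proof. by rewrite mulr_gt0// prodr_gt0. Qed.
Let N0 : 0 < \sum_l mu0 l * F l.
Proof. by rewrite (bigD1 j)//= ltr_wpDr// sumr_ge0. Qed.
Let p0 l : 0 <= posterior mu0 f S x l.
Proof. by rewrite divr_ge0// ltW. Qed.

(** Keeping only the terms of [l] and [j] in the normalizing sum bounds the posterior weight by a /
    (a + b), where a and b are the prior-weighted likelihoods of [l] and [j]. *)
Lemma posterior_le_sqrt l : l != j ->
  posterior mu0 f S x l <= Num.sqrt (mu0 l / mu0 j) *
    \prod_(k < n | S k) Num.sqrt (f l (x k) / f j (x k)).
Proof.
move=> lj; rewrite -sqrtr_prod; last first.
  by move=> k; rewrite divr_ge0// ltW.
rewrite -sqrtrM ?divr_ge0// ?(ltW mu0j)//.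
rewrite big_split/= prodfV mulrACA -invfM.
apply: le_trans (div_add_le_sqrt (mF0 l) mFj).
rewrite /posterior -/(F l); apply: ler_wpM2l => //.
rewrite lef_pV2 ?posrE//; last by rewrite ltr_wpDl.
rewrite (bigD1 l)//= lerD2l (bigD1 j) 1?eq_sym//= lerDl.
exact: sumr_ge0.
Qed.

(** The normalizing sum is positive, so the posterior weights sum to 1 and the weight missing at [j]
    equals the total weight of the other states. This mass counts twice in the l1 distance, whence
    [B *+ 2]. *)
Lemma value_posterior_dist :
  `|value u (posterior mu0 f S x) - value u (point_belief R j)| <=
  B *+ 2 * \sum_(l | l != j) (Num.sqrt (mu0 l / mu0 j) *
    \prod_(k < n | S k) Num.sqrt (f l (x k) / f j (x k))).
Proof.
apply: (le_trans (value_lipschitz _ _ uB)).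
have B0 : 0 <= B by apply: le_trans (uB ord0 ord0).
rewrite mulrnAl -mulrnAr ler_wpM2l//.
apply: (@le_trans _ _ ((\sum_(l | l != j) posterior mu0 f S x l) *+ 2)); last first.
  by rewrite lerMn2r ler_sum// => l; exact: posterior_le_sqrt.
have tot : posterior mu0 f S x j = 1 - \sum_(l | l != j) posterior mu0 f S x l.
  apply: (addIr (\sum_(l | l != j) posterior mu0 f S x l)); rewrite subrK.
  transitivity (\sum_l posterior mu0 f S x l); first by rewrite [RHS](bigD1 j).
  by rewrite /posterior -mulr_suml divff// gt_eqF.
rewrite (bigD1 j)//= tot /point_belief eqxx mulr2n.
apply: lerD.
  by rewrite addrAC subrr add0r normrN ger0_norm// sumr_ge0.
apply: ler_sum => l /negbTE lj.
by rewrite lj subr0 ger0_norm.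
Qed.

End posterior.

(** * Boundedness, measurability and integrability of the posterior value *)

Lemma posterior_ge0_le1 (R : realType) (M : nat) (mu0 : 'I_M.+1 -> R)
    (T : Type) (f : 'I_M.+1 -> T -> R) (n : nat) (S : pred 'I_n)
    (x : 'I_n -> T) (l : 'I_M.+1) :
  is_belief mu0 -> (forall l t, 0 <= f l t) ->
  0 <= posterior mu0 f S x l <= 1.
Proof.
move=> [m0 _] f0; rewrite /posterior.
have F0 j : 0 <= mu0 j * \prod_(k < n | S k) f j (x k).
  by rewrite mulr_ge0// prodr_ge0.
rewrite divr_ge0 ?sumr_ge0//=.
(* When the normalizing sum [N] is 0, the weight is 0 since the inverse of 0 is 0. *)
set N := \sum_j _; have N0 : 0 <= N by exact: sumr_ge0.
move: N0; rewrite le_eqVlt => /predU1P[<-|Np]; first by rewrite invr0 mulr0.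
by rewrite ler_pdivrMr// mul1r /N (bigD1 l)//= lerDl sumr_ge0.
Qed.

Lemma measurable_fun_bigmax (R : realType) d (T : measurableType d) (I : Type)
    (s : seq I) (h0 : T -> R) (h : I -> T -> R) :
  measurable_fun setT h0 -> (forall i, measurable_fun setT (h i)) ->
  measurable_fun setT (fun t => \big[Num.max/h0 t]_(i <- s) h i t).
Proof.
move=> mh0 mh; elim: s => [|i s IH]; first by under eq_fun do rewrite big_nil.
by under eq_fun do rewrite big_cons; exact: measurable_maxr.
Qed.

Lemma utility_bounded (R : realType) (K M : nat) (u : 'I_K.+1 -> 'I_M.+1 -> R) :
  exists B : R, forall a j, `|u a j| <= B.
Proof.
exists (\sum_a \sum_j `|u a j|) => a j.
rewrite (bigD1 a)//= (bigD1 j)//= -addrA lerDl addr_ge0 ?sumr_ge0//.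
by move=> b _; exact: sumr_ge0.
Qed.

Section signals.
Context (R : realType) (K M : nat) (u : 'I_K.+1 -> 'I_M.+1 -> R).
Context (mu0 : 'I_M.+1 -> R) (hmu0 : is_belief mu0).
Context d (T : measurableType d) (nu : {measure set T -> \bar R}).
Context (f : 'I_M.+1 -> T -> R) (hf : forall j, is_density nu (f j)).
Context dW (W : measurableType dW) (P : probability W R).
Context (n : nat) (X : 'I_n -> {RV P >-> T}).

Let mf l : measurable_fun setT (f l). Proof. by case: (hf l). Qed.
Let f0 l t : 0 <= f l t. Proof. by case: (hf l). Qed.

Lemma measurable_posterior_value (S : pred 'I_n) :
  measurable_fun setT (posterior_value u mu0 f S X).
Proof.
have mnum l : measurable_fun setT
    (fun w => mu0 l * \prod_(k < n | S k) f l (X k w)).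
  apply: measurable_funM => //; under eq_fun do rewrite big_mkcond.
  apply: measurable_prod => k _; case: (S k) => //.
  exact: measurableT_comp.
have mpost l : measurable_fun setT
    (fun w => posterior mu0 f S (fun k => X k w) l).
  apply: measurable_funM; first exact: mnum.
  apply: measurable_funV_ge0; first exact: measurable_sum.
  move=> w; apply: sumr_ge0 => j _; rewrite mulr_ge0 ?prodr_ge0//.
  by case: hmu0.
have mEU a : measurable_fun setT
    (fun w => expected_utility u (posterior mu0 f S (fun k => X k w)) a).
  by apply: measurable_sum => l; exact: measurable_funM.
exact: measurable_fun_bigmax.
Qed.

Lemma integrable_posterior_value (S : pred 'I_n) :
  P.-integrable setT (EFin \o posterior_value u mu0 f S X).
Proof.
apply: measurable_bounded_integrable => //.
- by apply: (le_lt_trans (probability_le1 P measurableT)); exact: ltry.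
- exact: measurable_posterior_value.
have [B uB] := utility_bounded u.
(* The zero weight vector is the reference point: the posterior weights lie in [0, 1], so its l1
   distance to the posterior is at most the number of states. *)
exists (`|value u (fun=> 0)| + B * M.+1%:R); split; first exact: num_real.
move=> y hy w _ /=; apply: le_trans (ltW hy).
rewrite -[posterior_value _ _ _ _ _ _](subrK (value u (fun=> 0))) addrC.
rewrite (le_trans (ler_normD _ _))// lerD2l.
apply: (le_trans (value_lipschitz _ _ uB)).
rewrite ler_wpM2l ?(le_trans _ (uB ord0 ord0))//.
rewrite -[X in _ <= X%:R]card_ord -sum1_card natr_sum ler_sum// => l _.
have /andP[p0 p1] := posterior_ge0_le1 S (fun k => X k w) l hmu0 f0.
by rewrite subr0 ger0_norm.
Qed.

End signals.

(** * Geometric rate of learning on each state event *)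

Section learning_rate.
Context (R : realType) (K M : nat) (u : 'I_K.+1 -> 'I_M.+1 -> R).
Context (mu0 : 'I_M.+1 -> R) (hmu0 : is_belief mu0).
Context d (T : measurableType d) (nu : {measure set T -> \bar R}).
Context (f : 'I_M.+1 -> T -> R) (hf : forall j, is_density nu (f j)).
Hypothesis hneq : forall j l : 'I_M.+1, j <> l ->
  exists2 A : set T, measurable A
    & density_law nu (f j) A <> density_law nu (f l) A.
Context dW (W : measurableType dW) (P : probability W R) (theta : W -> 'I_M.+1).

Let mf l : measurable_fun setT (f l). Proof. by case: (hf l). Qed.
Let f0 l t : 0 <= f l t. Proof. by case: (hf l). Qed.

(** The law with density [f j] gives mass 0 to the zero set of [f j], and there are finitely many
    components. *)
Lemma ae_density_gt0 (n : nat) (X : 'I_n -> {RV P >-> T}) (j : 'I_M.+1) :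
  cond_iid mu0 nu f theta X ->
  {ae P, forall w, theta w = j -> forall k, 0 < f j (X k w)}.
Proof.
move=> /(_ j)[mA hA hB].
suff aek k : {ae P, forall w, theta w = j -> 0 < f j (X k w)}.
  have aeall : {ae P, forall w, forall k, theta w = j -> 0 < f j (X k w)}.
    exact: filter_forall aek.
  by apply: filterS aeall => w h tw k; exact: h.
pose Z := f j @^-1` [set 0].
have mZ : measurable Z by rewrite -[Z]setTI; exact: mf.
(* A rectangle that constrains component [k] alone. *)
pose B (i : 'I_n) := if i == k then Z else setT.
have mB i : measurable (B i) by rewrite /B; case: ifP.
have := hB B mB; have -> : [set w | forall i, B i (X i w)] = X k @^-1` Z.
  apply/seteqP; split => w /=; first by move=> /(_ k); rewrite /B eqxx.
  by move=> Zw i; rewrite /B; case: eqP => [->|].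
have Z0 : density_law nu (f j) Z = 0%E.
  rewrite /density_law -(integral0 nu Z); apply: eq_integral => t.
  by rewrite inE /Z /= => ->.
rewrite (bigD1 k)//= {1}/B eqxx Z0 mul0e mule0 => P0.
exists (theta @^-1` [set j] `&` X k @^-1` Z); split.
- apply: measurableI => //; rewrite -[X in measurable X]setTI.
  exact: measurable_funP.
- exact: P0.
- move=> w /= /not_implyP[tw fw]; split => //.
  by apply/eqP; move: fw; rewrite lt0r f0 andbT => /negP/negPn.
Qed.

(** The constants are chosen before [n], [X], [S] and [j], so that one bound serves every number of
    senders, both with all components observed and with one left out. *)
Lemma learning_rate : exists C r : R, [/\ 0 <= C, 0 <= r, r < 1 &
  forall (n : nat) (X : 'I_n -> {RV P >-> T}) (S : pred 'I_n) (j : 'I_M.+1),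
  cond_iid mu0 nu f theta X ->
  (\int[P]_w (\1_(theta @^-1` [set j]) w *
     `|posterior_value u mu0 f S X w - value u (point_belief R j)|)%:E
   <= (C * r ^+ #|S|)%:E)%E].
Proof.
have [B uB] := utility_bounded u.
have B0 : 0 <= B by rewrite (le_trans _ (uB ord0 ord0)).
have m0 j : 0 <= mu0 j by case: hmu0.
have [rho hrho] : exists rho : 'I_M.+1 -> 'I_M.+1 -> R, forall j l, l != j ->
    [/\ 0 <= rho j l, rho j l < 1 &
    (\int[nu]_t (f j t * Num.sqrt (f l t / f j t))%:E = (rho j l)%:E)%E].
  suff /choice[rho hrho] (jl : 'I_M.+1 * 'I_M.+1) : exists r, jl.2 != jl.1 ->
      [/\ 0 <= r, r < 1 & (\int[nu]_t (f jl.1 t *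
        Num.sqrt (f jl.2 t / f jl.1 t))%:E = r%:E)%E].
    by exists (fun j l => rho (j, l)) => j l lj; exact: (hrho (j, l)).
  case: (eqVneq jl.2 jl.1) => [_|jl12]; first by exists 0.
  have [A mA neqA] := hneq (fun e => negP jl12 (introT eqP (esym e))).
  by have [r hr] := bhattacharyya_lt1 (hf _) (hf _) mA neqA; exists r.
(* The largest Bhattacharyya coefficient over the finitely many pairs of distinct states, hence
   below 1; with a single state it is the default 0. *)
pose r := \big[Num.max/0]_(jl : 'I_M.+1 * 'I_M.+1 | jl.2 != jl.1) rho jl.1 jl.2.
(* Lipschitz factor times roots of prior odds times the probability of the state event. *)
pose c j := B *+ 2 * \sum_(l | l != j) Num.sqrt (mu0 l / mu0 j) * mu0 j.
have c0 j : 0 <= c j.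
  rewrite mulr_ge0 ?mulrn_wge0 ?sumr_ge0// => l _.
  by rewrite mulr_ge0 ?sqrtr_ge0.
exists (\sum_j c j), r; split.
- exact: sumr_ge0.
- exact: bigmax_ge_id.
- by apply: bigmax_lt => // -[j l] /= /hrho[].
move=> n X S j hX; have [mA hA hB] := hX j.
set A := theta @^-1` [set j] in mA hA hB *.
set V := posterior_value u mu0 f S X.
have mV : measurable_fun setT
    (fun w => \1_A w * `|V w - value u (point_belief R j)|).
  apply: measurable_funM => //; apply: measurableT_comp => //.
  apply: measurable_funB => //; exact: measurable_posterior_value.
have : 0 <= mu0 j by [].
(* A state of prior probability 0 gives a null event, on which the integral vanishes. *)
rewrite le_eqVlt => /predU1P[mu0j|mu0j].
  rewrite (_ : (\int[P]_w _ = 0)%E); last first.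
    transitivity (\int[P]_(w in A) (`|V w - value u (point_belief R j)|)%:E)%E.
      rewrite [RHS]integral_mkcond; apply: eq_integral => w _.
      by rewrite patchE indicE; case: ifP; rewrite ?mul1r ?mul0r.
    apply: null_set_integral => //; last first.
      exact: (etrans hA (congr1 EFin (esym mu0j))).
    apply/measurable_EFinP/measurable_funTS; apply: measurableT_comp => //.
    apply: measurable_funB => //; exact: measurable_posterior_value.
  rewrite lee_fin mulr_ge0 ?sumr_ge0// exprn_ge0//; exact: bigmax_ge_id.
(* Unobserved components get the factor 1, which integrates to 1 against [f j]; the product over all
   [n] components thus yields the exponent [#|S|]. *)
pose phi l (k : 'I_n) t := if S k then Num.sqrt (f l t / f j t) else 1.
pose s l := B *+ 2 * Num.sqrt (mu0 l / mu0 j).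
have s0 l : 0 <= s l by rewrite mulr_ge0 ?mulrn_wge0 ?sqrtr_ge0.
have phi0 l k t : 0 <= phi l k t by rewrite /phi; case: ifP.
have mphi l k : measurable_fun setT (phi l k).
  rewrite /phi; case: (S k) => //; apply: measurable_fun_sqrt.
  by apply: measurable_funM => //; exact: measurable_funV_ge0.
have mprod l : measurable_fun setT
    (fun w => \1_A w * \prod_(k < n) phi l k (X k w)).
  apply: measurable_funM => //; apply: measurable_prod => k _.
  exact: measurableT_comp.
apply: (@le_trans _ _ (\int[P]_w \sum_(l | l != j)
    ((s l)%:E * (\1_A w * \prod_(k < n) phi l k (X k w))%:E))%E).
  apply: ae_ge0_le_integral => //.
  - exact/measurable_EFinP.
  - move=> w _; apply: sume_ge0 => l _.
    by rewrite -EFinM lee_fin mulr_ge0// mulr_ge0// prodr_ge0.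
  - under eq_fun do rewrite big_mkcond.
    apply: emeasurable_sum => l; case: (l != j) => //.
    by apply: emeasurable_funM => //; exact/measurable_EFinP.
  have aeX := ae_density_gt0 j hX.
  apply: filterS aeX => w hw _.
  under eq_bigr do rewrite -EFinM.
  rewrite sumEFin lee_fin indicE; have [/set_mem Aw|_] := boolP (w \in A);
    last by rewrite mul0r big1// => l _; rewrite mul0r mulr0.
  rewrite mul1r (le_trans (value_posterior_dist uB hmu0 f0 S mu0j (hw Aw)))//.
  rewrite mulr_sumr ler_sum// => l lj.
  by rewrite mul1r /s -mulrA big_mkcond.
under eq_integral do rewrite big_mkcond.
rewrite ge0_integral_sum//; last 2 first.
- move=> l; case: (l != j) => //.
  by apply: emeasurable_funM => //; exact/measurable_EFinP.
- move=> l w _; case: (l != j) => //.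
  by rewrite -EFinM lee_fin mulr_ge0// mulr_ge0// prodr_ge0.
apply: (@le_trans _ _ (\sum_(l | l != j) (s l * (mu0 j * r ^+ #|S|))%:E)%E); last first.
  rewrite sumEFin lee_fin [X in _ <= X * _](bigD1 j)//= mulrDl.
  rewrite -[X in X <= _]addr0 lerD//; last first.
    by rewrite mulr_ge0 ?sumr_ge0// exprn_ge0//; exact: bigmax_ge_id.
  rewrite /c mulr_sumr mulr_suml ler_sum// => l _.
  by rewrite /s !mulrA.
rewrite [leRHS]big_mkcond; apply: lee_sum => l _.
case: ifPn => [lj|]; last by rewrite integral0.
have [rho0 rho1 Erho] := hrho j l lj.
rewrite ge0_integralZl//; last 3 first.
- exact/measurable_EFinP.
- by move=> w _; rewrite lee_fin mulr_ge0// prodr_ge0.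
- by rewrite lee_fin.
rewrite (@integral_prod_iid R _ W P _ T nu (f j) (hf j) n (fun k => X k) _ A mA
  (mu0 j) hA hB (phi l) (fun k => if S k then rho j l else 1))//.
- rewrite -EFinM lee_fin ler_wpM2l// ler_wpM2l// -big_mkcond prodr_const.
  apply: lerXn2r; rewrite ?nnegrE//; first exact: bigmax_ge_id.
  exact: (@le_bigmax_cond _ _ _ 0 (j, l) (fun jl => jl.2 != jl.1)
    (fun jl => rho jl.1 jl.2)).
- move=> k; rewrite /phi; case: (S k) => //.
  by have [_ _ <-] := hf j; under eq_integral do rewrite mulr1.
Qed.

End learning_rate.

(** * From geometric bounds to conditional expectations and residual values *)

(** With s the square root of [r], split r^n as s^n s^n. One factor absorbs n + 1, as (n + 1) s^n is
    at most the geometric sum 1 + s + ... + s^n; the other tends to 0. *)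
Lemma cvg_natmul_expr (R : realType) (r : R) : 0 <= r -> r < 1 ->
  (fun n => n.+1%:R * r ^+ n) @ \oo --> 0.
Proof.
move=> r0 r1; pose s := Num.sqrt r.
have s0 : 0 <= s by exact: sqrtr_ge0.
have s1 : s < 1 by rewrite -sqrtr1 ltr_sqrt.
have bound n : n.+1%:R * s ^+ n <= (1 - s)^-1.
  rewrite -div1r ler_pdivlMr ?subr_gt0//.
  apply: (@le_trans _ _ (1 - s ^+ n.+1)); last by rewrite gerBl exprn_ge0.
  have -> : 1 - s ^+ n.+1 = (1 - s) * \sum_(i < n.+1) s ^+ i.
    by rewrite -opprB subrX1 -mulNr opprB.
  rewrite mulrC ler_wpM2l ?subr_ge0 ?(ltW s1)//.
  rewrite mulr_natl -[X in _ *+ X]card_ord -sumr_const.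
  by apply: ler_sum => i _; rewrite ler_wiXn2l ?(ltW s1)// -ltnS.
apply: (@squeeze_cvgr _ _ _ _ (fun=> 0) (fun n => (1 - s)^-1 * s ^+ n)).
- apply: nearW => n; rewrite mulr_ge0 ?exprn_ge0//=.
  rewrite -(sqr_sqrtr r0) -/s expr2 exprMn mulrA.
  by rewrite ler_wpM2r ?exprn_ge0.
- exact: cvg_cst.
- rewrite -[X in _ --> X](mulr0 (1 - s)^-1).
  by apply: cvgM; [exact: cvg_cst|apply: cvg_expr; rewrite ger0_norm].
Qed.

Section limits.
Context (R : realType) (K M : nat) (u : 'I_K.+1 -> 'I_M.+1 -> R).
Context (mu0 : 'I_M.+1 -> R) (hmu0 : is_belief mu0).
Context d (T : measurableType d) (nu : {measure set T -> \bar R}).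
Context (f : 'I_M.+1 -> T -> R) (hf : forall j, is_density nu (f j)).
Context dW (W : measurableType dW) (P : probability W R) (theta : W -> 'I_M.+1).
Context (n : nat) (X : 'I_n -> {RV P >-> T}).
Hypothesis hX : cond_iid mu0 nu f theta X.

Let v j := value u (point_belief R j).
Let V S := posterior_value u mu0 f S X.
Let mV S : measurable_fun setT (V S).
Proof. exact: measurable_posterior_value. Qed.
Let iV S : P.-integrable setT (EFin \o V S).
Proof. exact: integrable_posterior_value. Qed.

(** A version of the conditional expectation given the state is constant on each state event, where
    it equals the average of the posterior value. This makes the bound pointwise at [w]. *)
Lemma cond_exp_state_dist (S : pred 'I_n) (E : W -> R) (c : R) (w : W) :
  is_cond_exp P (sigma_state theta) (V S) E ->
  0 < mu0 (theta w) ->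
  (\int[P]_w' (\1_(theta @^-1` [set theta w]) w' *
     `|V S w' - v (theta w)|)%:E <= c%:E)%E ->
  `|E w - v (theta w)| <= (mu0 (theta w))^-1 * c.
Proof.
move=> [hE iE intE] m0 hc; have [mA hA _] := hX (theta w).
set A := theta @^-1` [set theta w] in mA hA hc.
(* The level set of [E] through [w] is a preimage under [theta], so it contains the whole state
   event of [w]. *)
have [Z _ hZ] := hE _ (measurable_set1 (E w)).
have Ecst w' : A w' -> E w' = E w.
  move=> Aw'; have : (E @^-1` [set E w]) w by [].
  rewrite -hZ => -[_ /= Zw]; have : (E @^-1` [set E w]) w'; last by [].
  by rewrite -hZ; split => //=; rewrite Aw'.
have GA : sigma_state theta A by exists [set theta w] => //; rewrite setTI.
have mD : measurable_fun setT (fun w' => V S w' - v (theta w)).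
  exact: measurable_funB.
have := intE _ GA.
rewrite (_ : (\int[P]_(w' in A) (E w')%:E)%E = ((E w) * mu0 (theta w))%:E);
  last first.
  transitivity (\int[P]_(w' in A) (cst (E w)%:E w'))%E.
    by apply: eq_integral => w' /set_mem /Ecst ->.
  by rewrite integral_cst// EFinM; congr (_ * _)%E.
move=> EV.
have Ev : ((E w - v (theta w)) * mu0 (theta w))%:E =
    (\int[P]_(w' in A) (V S w' - v (theta w))%:E)%E.
  under eq_integral do rewrite EFinB.
  rewrite integralB_EFin//; last 2 first.
  - exact: integrableS (iV S).
  - exact: finite_measure_integrable_cst.
  rewrite -EV mulrBl EFinB; congr (_ - _)%E.
  by rewrite [RHS]integral_cst// EFinM; congr (_ * _)%E.
rewrite ler_pdivlMl// -{1}(gtr0_norm m0) mulrC -normrM -lee_fin -abse_EFin Ev.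
apply: le_trans hc.
apply: (le_trans (le_abse_integral _ mA _)).
  by apply/measurable_EFinP; exact: measurable_funTS.
rewrite integral_mkcond le_eqVlt; apply/orP; left; apply/eqP.
apply: eq_integral => w' _.
by rewrite patchE indicE; case: ifP; rewrite ?mul1r ?mul0r.
Qed.

(** Conditioning preserves the mean, so the expected residual value is the mean difference of two
    posterior values. Passing through the full-information value on each of the [M.+1] state events
    gives the bound. *)
Lemma residual_value_dist (i : 'I_n) (r : W -> R) (c c' : R) :
  is_residual_value u mu0 f X i r ->
  (forall j, \int[P]_w (\1_(theta @^-1` [set j]) w * `|V predT w - v j|)%:E
     <= c%:E)%E ->
  (forall j, \int[P]_w (\1_(theta @^-1` [set j]) w * `|V (predC1 i) w - v j|)%:E
     <= c'%:E)%E ->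
  (`|'E_P[r]| <= (M.+1%:R * (c + c'))%:E)%E.
Proof.
move=> [g [hg ig intg] hr] hc hc'.
have Gset : sigma_signals (predC1 i) X setT.
  rewrite -[setT](setD0); have [s0 sD _] := smallest_sigma_algebra setT
    (\big[setU/set0]_(k < n | predC1 i k)
       preimage_set_system setT (X k) measurable).
  exact: sD.
rewrite unlock (_ : (\int[P]_w (r w)%:E)%E =
    (\int[P]_w (V predT w - V (predC1 i) w)%:E)%E); last first.
  under eq_integral do rewrite hr EFinB.
  rewrite integralB_EFin//; last exact: iV.
  under [RHS]eq_integral do rewrite EFinB.
  by rewrite integralB_EFin// intg.
have mD : measurable_fun setT (fun w => V predT w - V (predC1 i) w).
  exact: measurable_funB.
apply: (le_trans (le_abse_integral _ measurableT _)).
  exact/measurable_EFinP.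
have mI S' j : measurable_fun setT
    (fun w => (\1_(theta @^-1` [set j]) w * `|V S' w - v j|)%:E).
  have [mA _ _] := hX j.
  apply/measurable_EFinP/measurable_funM => //; apply: measurableT_comp => //.
  exact: measurable_funB.
have I0 S' j w : (0 <= (\1_(theta @^-1` [set j]) w * `|V S' w - v j|)%:E)%E.
  by rewrite lee_fin mulr_ge0.
apply: (@le_trans _ _ (\int[P]_w \sum_j
    ((\1_(theta @^-1` [set j]) w * `|V predT w - v j|)%:E +
     (\1_(theta @^-1` [set j]) w * `|V (predC1 i) w - v j|)%:E))%E).
  apply: ge0_le_integral => //.
  - by apply/measurable_EFinP; exact: measurableT_comp.
  - by apply: emeasurable_sum => j; exact: emeasurable_funD.
  (* The term of the true state gives the triangle inequality; the other terms are nonnegative. *)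
  move=> w _; rewrite (bigD1 (theta w))//= -[leLHS]adde0; apply: leeD.
    rewrite indicE mem_set// !mul1r -EFinD lee_fin.
    by rewrite (distrC (V (predC1 i) w)); exact: ler_distD.
  by apply: sume_ge0 => j _; exact: adde_ge0.
rewrite ge0_integral_sum//; last 2 first.
- by move=> j; exact: emeasurable_funD.
- by move=> j w _; exact: adde_ge0.
have -> : (M.+1%:R * (c + c'))%:E = (\sum_(j < M.+1) (c%:E + c'%:E))%E.
  by rewrite sumEFin sumr_const card_ord mulr_natl.
apply: lee_sum => j _; rewrite ge0_integralD//.
exact: leeD.
Qed.

End limits.

(** * Almost sure learning and vanishing total residual value *)

Theorem proposition1 (R : realType) (K M : nat) (hMK : (M.+1 <= K.+1)%N)
  (u : 'I_K.+1 -> 'I_M.+1 -> R)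
  (hu : forall (j : 'I_M.+1) (k : 'I_K.+1),
     k <> widen_ord hMK j -> u k j < u (widen_ord hMK j) j)
  (mu0 : 'I_M.+1 -> R) (hmu0 : is_belief mu0)
  (d : measure_display) (T : measurableType d)
  (nu : {measure set T -> \bar R}) (f : 'I_M.+1 -> T -> R)
  (hf : forall j, is_density nu (f j))
  (hac : forall j l : 'I_M.+1, j <> l ->
     density_law nu (f j) `<< density_law nu (f l))
  (hneq : forall j l : 'I_M.+1, j <> l ->
     exists2 A : set T, measurable A
       & density_law nu (f j) A <> density_law nu (f l) A)
  (dW : measure_display) (W : measurableType dW) (P : probability W R)
  (theta : W -> 'I_M.+1)
  (* X n k is the component of sender k when there are n senders *)
  (X : forall n : nat, 'I_n -> {RV P >-> T})
  (hX : forall n, cond_iid mu0 nu f theta (X n)) :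
  (forall E : nat -> W -> R,
     (forall n, is_cond_exp P (sigma_state theta)
                  (posterior_value u mu0 f predT (X n)) (E n)) ->
     {ae P, forall w,
        (fun n => E n w) @ \oo --> value u (point_belief R (theta w))})
  /\
  (forall (i : forall n : nat, 'I_n.+1) (v : nat -> W -> R),
     (forall n, is_residual_value u mu0 f (X n.+1) (i n) (v n)) ->
     (fun n => (n.+1%:R%:E * 'E_P[v n])%E) @ \oo --> 0%E).

Proof.
have [C [r [C0 r0 r1 hC]]] := learning_rate u hmu0 hf hneq P theta.
have cvr : (fun n => r ^+ n) @ \oo --> (0 : R).
  by apply: cvg_expr; rewrite ger0_norm.
split=> [E hE|i v hv].
  (* The exceptional null set consists of the states of prior probability 0; the law of [theta] is
     read off from the instance with no senders. *)
  have aepos : {ae P, forall w, 0 < mu0 (theta w)}.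
    have aej (j : 'I_M.+1) : {ae P, forall w, theta w = j -> 0 < mu0 j}.
      have [mA hA _] := hX 0%N j.
      have : 0 <= mu0 j by case: hmu0.
      rewrite le_eqVlt => /predU1P[mu0j|mu0j]; last exact: aeW.
      exists (theta @^-1` [set j]); split => //.
        by apply: (etrans hA); rewrite -mu0j.
      by move=> w /= /not_implyP[].
    have aeall : {ae P, forall w, forall j, theta w = j -> 0 < mu0 j}.
      exact: filter_forall aej.
    by apply: filterS aeall => w h; exact: h.
  apply: filterS aepos => w m0.
  pose c := (mu0 (theta w))^-1 * C.
  apply/subr_cvg0/norm_cvg0P => /=.
  apply: (@squeeze_cvgr _ _ _ _ (fun=> 0) (fun n => c * r ^+ n)).
  - apply: nearW => n; rewrite normr_ge0/= -mulrA.
    apply: (cond_exp_state_dist hmu0 hf (hX n) (hE n) m0).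
    have := hC n (X n) predT (theta w) (hX n).
    by rewrite cardT size_enum_ord.
  - exact: cvg_cst.
  - by rewrite -[X in _ --> X](mulr0 c); apply: cvgM => //; exact: cvg_cst.
pose c := M.+1%:R * (C + C).
have bound n : (`|n.+1%:R%:E * 'E_P[v n]| <= (c * (n.+1%:R * r ^+ n))%:E)%E.
  rewrite abseM gee0_abs ?lee_fin// mulrCA EFinM lee_wpmul2l ?lee_fin//.
  (* Among [n.+1] senders, the full sample has [n.+1] components and the sample without [i n] has
     [n]; as [r] is below 1, the rate [r ^+ n] covers both. *)
  have hn S : (n <= #|S|)%N -> forall j,
      (\int[P]_w (\1_(theta @^-1` [set j]) w *
        `|posterior_value u mu0 f S (X n.+1) w - value u (point_belief R j)|)%:E
       <= (C * r ^+ n)%:E)%E.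
    move=> nS j; apply: le_trans (hC _ _ S j (hX n.+1)) _.
    by rewrite lee_fin ler_wpM2l// ler_wiXn2l// ltW.
  have := residual_value_dist hmu0 hf (hX n.+1) (hv n)
    (hn predT _) (hn (predC1 (i n)) _).
  rewrite -mulrDl mulrA; apply.
  - by rewrite cardT size_enum_ord.
  - by rewrite cardC1 card_ord.
have cvc : (fun n => (c * (n.+1%:R * r ^+ n))%:E) @ \oo --> (0 : \bar R)%E.
  apply: cvg_EFin; first exact: nearW.
  rewrite -[X in _ --> X](mulr0 c); apply: cvgM; first exact: cvg_cst.
  exact: cvg_natmul_expr.
apply/cvg_abse0P.
apply: (@squeeze_cvge _ _ _ _ (fun=> 0%E) _
  (fun n => (c * (n.+1%:R * r ^+ n))%:E)) => //; last exact: cvg_cst.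
by apply: nearW => n; rewrite abse_ge0 bound.
Qed.
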